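(* Let $k\ge3$ be an integer, let $\lambda\in\mathbb{C}\setminus\{-n/2:n\in\mathbb{N}\}$, and let $\{p_n\}_{n\ge0}$ be the monic sieved OPS of the second kind, $p_n(x)=\nu_nB_n^\lambda(x;k)$ with $\nu_n:=\lfloor n/k\rfloor!/\{2^n(\lambda+1)_{\lfloor n/k\rfloor}\}$. Then for all $n\ge1$ and $0\le j\le k-1$ the polynomial $p_{nk+j}$ satisfies the second order differential equation $$J_{nk+j}(x)p_{nk+j}''(x)+K_{nk+j}(x)p_{nk+j}'(x)+L_{nk+j}(x)p_{nk+j}(x)=0,$$ where $$J_{nk+j}=\Phi M_{nk+j},\qquad K_{nk+j}=\Psi M_{nk+j}-\Phi M_{nk+j}',$$ $$L_{nk+j}=N_{nk+j}M_{nk+j}'+\big(\Omega_j-N_{nk+j}'\big)M_{nk+j},$$ with $$\Phi(x)=(1-x^2)\widehat U_{k-1}(x),\qquad \Psi(x)=-\big(2x\widehat U_{k-1}(x)+k(2\lambda+1)\widehat T_k(x)\big),$$ $$\Omega_j(x)=(nk+j+1)(nk+j+2+2\lambda k)\widehat U_{k-1}(x)-\tfrac{\lambda k}{2}\widehat U_j(x)\widehat U_{k-j-3}(x),$$ $$M_{nk+j}(x)=-2(nk+j+1+\lambda k)\widehat U_{k-1}(x)-\tfrac{\lambda k}{2}\big(\widehat U_{j-1}(x)\widehat U_{k-j-2}(x)-\widehat U_j(x)\widehat U_{k-j-3}(x)\big),$$ $$N_{nk+j}(x)=(nk+j+2+2\lambda k)\,x\,\widehat U_{k-1}(x)-\lambda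 k\,\epsilon_j\,\widehat U_{k-2}(x)+\tfrac{\lambda k}{8}\big(\widehat U_{j-1}(x)\widehat U_{k-j-3}(x)-\widehat U_j(x)\widehat U_{k-j-4}(x)\big),$$ and $\epsilon_{k-1}:=1$, $\epsilon_{k-2}:=0$, $\epsilon_j:=\frac12$ for $0\le j\le k-3$.
   Context: $\mathbb{N}=\{1,2,\dots\}$. $(\alpha)_0:=1$ and $(\alpha)_n:=\alpha(\alpha+1)\cdots(\alpha+n-1)$ for $n\ge1$. OPS = orthogonal polynomial sequence (with respect to a regular linear functional on complex polynomials). The polynomial $\Omega_j$ depends also on $n$. Chebyshev polynomials: $T_n(\cos\theta)=\cos n\theta$, $U_n(\cos\theta)=\sin((n+1)\theta)/\sin\theta$; monic versions $\widehat T_n:=2^{1-n}T_n$ ($n\ge 1$), $\widehat U_n:=2^{-n}U_n$ ($n\ge0$), and by convention $\widehat U_n:=0$ for every negative index $n$. Sieved ultraspherical polynomials of the second kind: the polynomials $C_n(x;\beta|q)$ are defined by $C_0(x;\beta|q)=1$, $C_1(x;\beta|q)=2x(1-\beta)/(1-q)$ and, for $n\ge 1$, $2x(1-\beta q^n)C_n=(1-q^{n+1})C_{n+1}+(1-\beta^2q^{n-1})C_{n-1}$, with $|q|<1$. With $\omega_k:=e^{2\pi i/k}$, $B_n^\lambda(x;k):=\lim_{s\to1}C_n(x;s^{\lambda k+1}\omega_k\,|\,s\omega_k)$ (limit over $s\in(0,1)$). Equivalently, the monic polynomials $p_n$ satisfy $p_0=1$, $p_1=x$, $p_{N+1}=xp_N-\gamma_Np_{N-1}$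 ($N\ge1$), where $\gamma_{mk}=\frac{m}{4(m+\lambda)}$ for $m\ge1$, $\gamma_{mk+k-1}=\frac{m+1+2\lambda}{4(m+1+\lambda)}$ for $m\ge0$, and $\gamma_N=\frac14$ for all other $N\ge1$. *)

(* Defs.v *)
From HB Require Import structures.
From mathcomp Require Import all_boot all_order all_algebra.
From mathcomp Require Import complex ring.
From mathcomp Require Import all_classical all_reals all_analysis.
Set Implicit Arguments.
Unset Strict Implicit.
Unset Printing Implicit Defensive.
Import Order.TTheory GRing.Theory Num.Theory.
Import numFieldNormedType.Exports.
Local Open Scope classical_set_scope.
Local Open Scope ring_scope.
Local Open Scope complex_scope.

(** * Chebyshev polynomials

  [chebT] and [chebU] are given by their recurrences; [chebT_cos] and
  [chebU_cos] show that they are the polynomials with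
  T_n (cos t) = cos (n t) and U_n (cos t) = sin ((n + 1) t) / sin t. *)

Fixpoint chebT {F : comNzRingType} (n : nat) : {poly F} :=
  match n with
  | 0 => 1
  | 1 => 'X
  | (l.+1 as m).+1 => 2 *: ('X * chebT m) - chebT l
  end.

Fixpoint chebU {F : comNzRingType} (n : nat) : {poly F} :=
  match n with
  | 0 => 1
  | 1 => 2 *: 'X
  | (l.+1 as m).+1 => 2 *: ('X * chebU m) - chebU l
  end.

Lemma chebTSS (F : comNzRingType) n :
  chebT n.+2 = 2 *: ('X * chebT n.+1) - chebT n :> {poly F}.
Proof. by []. Qed.

Lemma chebUSS (F : comNzRingType) n :
  chebU n.+2 = 2 *: ('X * chebU n.+1) - chebU n :> {poly F}.
Proof. by []. Qed.

Lemma map_chebT (F G : comNzRingType) (f : {rmorphism F -> G}) n :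
  map_poly f (chebT n) = chebT n.
Proof.
elim/ltn_ind: n => -[|[|n]] IH; first by rewrite rmorph1.
  by rewrite /= map_polyX.
rewrite !chebTSS rmorphB /= map_polyZ rmorphM /= map_polyX rmorph_nat.
by rewrite (IH n.+1) ?(IH n) ?ltnS ?leqnSn.
Qed.

Lemma map_chebU (F G : comNzRingType) (f : {rmorphism F -> G}) n :
  map_poly f (chebU n) = chebU n.
Proof.
elim/ltn_ind: n => -[|[|n]] IH; first by rewrite rmorph1.
  by rewrite /= map_polyZ map_polyX rmorph_nat.
rewrite !chebUSS rmorphB /= map_polyZ rmorphM /= map_polyX rmorph_nat.
by rewrite (IH n.+1) ?(IH n) ?ltnS ?leqnSn.
Qed.

Lemma chebT_cos (R : realType) (n : nat) (t : R) :
  (chebT n : {poly R[i]}).[(cos t)%:C] = (cos (n%:R * t))%:C.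
Proof.
rewrite -(map_chebT (real_complex R)) horner_map; congr (_%:C).
elim/ltn_ind: n => -[|[|n]] IH.
- by rewrite /= hornerE mul0r cos0.
- by rewrite /= hornerX mul1r.
rewrite chebTSS hornerD hornerN hornerZ hornerM hornerX !IH //.
have -> : n.+2%:R * t = n.+1%:R * t + t by rewrite -addn1 natrD mulrDl mul1r.
have -> : n%:R * t = n.+1%:R * t - t by rewrite -addn1 natrD mulrDl mul1r addrK.
by rewrite cosB cosD; ring.
Qed.

Lemma chebU_cos (R : realType) (n : nat) (t : R) :
  (chebU n : {poly R[i]}).[(cos t)%:C] * (sin t)%:C = (sin (n.+1%:R * t))%:C.
Proof.
rewrite -(map_chebU (real_complex R)) horner_map -rmorphM; congr (_%:C).
elim/ltn_ind: n => -[|[|n]] IH.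
- by rewrite /= hornerE !mul1r.
- by rewrite /= hornerZ hornerX (mulr_natl t) mulr2n sinD; ring.
have IH1 := IH n.+1 (ltnSn _); have IH0 := IH n (leqnSn _).
rewrite chebUSS hornerD hornerN hornerZ hornerM hornerX mulrBl IH0.
rewrite -!mulrA IH1.
have -> : n.+3%:R * t = n.+2%:R * t + t by rewrite -addn1 natrD mulrDl mul1r.
have -> : n.+1%:R * t = n.+2%:R * t - t
  by rewrite -[n.+2]addn1 natrD mulrDl mul1r addrK.
by rewrite sinB sinD; ring.
Qed.

(** Monic versions; [hatU] is indexed by [int] and is 0 at negative indices
  (not the usual extension of U_n by its recurrence). *)

Definition hatT {F : fieldType} (n : nat) : {poly F} := 2 ^- n.-1 *: chebT n.

Definition hatU {F : fieldType} (z : int) : {poly F} :=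
  match z with
  | Posz n => 2 ^- n *: chebU n
  | Negz _ => 0
  end.

(** * Sieved ultraspherical polynomials of the second kind *)

Definition cexp {R : realType} (z : R[i]) : R[i] :=
  let: a +i* b := z in (expR a)%:C * (cos b +i* sin b).

(** Principal power [s ^ z] of a positive real [s]. *)
Definition cpowR {R : realType} (s : R) (z : R[i]) : R[i] :=
  cexp (z * (ln s)%:C).

Definition omega {R : realType} (k : nat) : R[i] :=
  cexp ((2 * pi / k%:R) *i).

(** C_n(x; beta | q); the divisions are genuine as soon as [`|q| < 1]. *)
Fixpoint qultra {F : fieldType} (beta q : F) (n : nat) : {poly F} :=
  match n with
  | 0 => 1
  | 1 => (2 * (1 - beta) / (1 - q)) *: 'X
  | (l.+1 as m).+1 =>
      (1 - q ^+ m.+1)^-1 *: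
        ((2 * (1 - beta * q ^+ m)) *: ('X * qultra beta q m)
         - (1 - beta ^+ 2 * q ^+ l) *: qultra beta q l)
  end.

(** B_n^lambda(x; k). The cast to [numFieldType] selects the topology that
  the modulus induces on [R[i]]. *)
Definition sievedB {R : realType} (k : nat) (lam : R[i]) (n : nat) (x : R[i])
    : R[i] :=
  lim (((qultra (cpowR s (lam * k%:R + 1) * omega k) (s%:C * omega k) n).[x]
          : (R[i] : numFieldType)) @[s --> (1 : R)^'-]).

Definition poch {F : fieldType} (a : F) (n : nat) : F :=
  \prod_(i < n) (a + i%:R).

Definition nu {F : fieldType} (k : nat) (lam : F) (n : nat) : F :=
  (n %/ k)`!%:R / (2 ^+ n * poch (lam + 1) (n %/ k)).

(** * Coefficients of the differential equation *)

Section Coefficients.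
Variables (F : fieldType) (k : nat) (lam : F).

Definition odePhi : {poly F} := (1 - 'X^2) * hatU (k%:Z - 1).

Definition odePsi : {poly F} :=
  - (2 *: ('X * hatU (k%:Z - 1)) + (k%:R * (2 * lam + 1)) *: hatT k).

Definition eps (j : nat) : F :=
  if j == (k - 1)%N then 1 else if j == (k - 2)%N then 0 else 2^-1.

Variables n j : nat.

Let ind : F := (n * k + j)%N%:R.

Definition odeOmega : {poly F} :=
  ((ind + 1) * (ind + 2 + 2 * lam * k%:R)) *: hatU (k%:Z - 1)
  - (lam * k%:R / 2) *: (hatU j%:Z * hatU (k%:Z - j%:Z - 3)).

Definition odeM : {poly F} :=
  - (2 * (ind + 1 + lam * k%:R)) *: hatU (k%:Z - 1)
  - (lam * k%:R / 2) *:
      (hatU (j%:Z - 1) * hatU (k%:Z - j%:Z - 2)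
       - hatU j%:Z * hatU (k%:Z - j%:Z - 3)).

Definition odeN : {poly F} :=
  (ind + 2 + 2 * lam * k%:R) *: ('X * hatU (k%:Z - 1))
  - (lam * k%:R * eps j) *: hatU (k%:Z - 2)
  + (lam * k%:R / 8) *:
      (hatU (j%:Z - 1) * hatU (k%:Z - j%:Z - 3)
       - hatU j%:Z * hatU (k%:Z - j%:Z - 4)).

Definition odeJ : {poly F} := odePhi * odeM.

Definition odeK : {poly F} := odePsi * odeM - odePhi * odeM^`().

Definition odeL : {poly F} := odeN * odeM^`() + (odeOmega - odeN^`()) * odeM.

End Coefficients.

(* Main.v *)
Require Import Defs.
From mathcomp Require Import all_boot all_order all_algebra.
From mathcomp Require Import complex ring lra zify.
From mathcomp Require Import all_classical all_reals all_analysis.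
Set Implicit Arguments.
Unset Strict Implicit.
Unset Printing Implicit Defensive.
Import Order.TTheory GRing.Theory Num.Theory.
Local Open Scope ring_scope.

(** The factors [1 - q ^ N] of the q-recurrence tend to [1 - w ^ N], where
  [w] is a primitive [k]-th root of unity. When [k] does not divide [N] this
  is not zero and the coefficients of the recurrence tend to those of the
  Chebyshev recurrence; when [N = m k] numerator and denominator both vanish
  and the quotient of their derivatives gives the factors [(lam + m) / m] and
  [(2 lam + m) / m]. So [B_n] is the polynomial [sieved k lam n]
  ([sievedB_horner]), and [p n] is a scalar multiple of it.

  Between two multiples of [k] the limit recurrence is that of the Chebyshev
  polynomials, and from one block to the next it is that of the Gegenbauer
  polynomials [G_n = C_n^(lam+1)]. Hence ([sieved_gegenT])
<<
    B_(nk+j) = U_j * G_n(T_k) + U_(k-j-2) * G_(n-1)(T_k).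
>>
  The pair [G_n, G_(n-1)] satisfies a first order linear system with
  denominator [1 - t^2]. Since [1 - T_k^2 = (1 - x^2) U_(k-1)^2] and
  [T_k' = k U_(k-1)], the substitution [t = T_k] yields a system with
  denominator [(1 - x^2) U_(k-1)], which is a multiple of [Phi]
  ([deriv_gegenT]).

  Therefore [Phi p' = N p + M q], where [q] is the next polynomial of the
  recurrence, up to a factor, and [q'] satisfies a relation of the same kind;
  eliminating [q] gives the differential equation ([ode_of_structure]). Both
  relations are checked on the coefficients of [G_n(T_k)] and
  [G_(n-1)(T_k)]. The Chebyshev polynomials in these coefficients, and
  [1 - x^2] times their derivatives, are polynomials in [x], [U_j],
  [U_(j-1)], [U_(k-1)], [U_(k-2)] ([Upred_cassini], [deriv_Upred]), so the
  relations become ring identities modulo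
  [U_m^2 - 2 x U_m U_(m-1) + U_(m-1)^2 = 1] for [m = j] and [m = k - 1]. *)

(** * Second order equations from first order relations *)

Definition ode (F : comNzRingType) (Phi Psi Om M N p : {poly F}) : {poly F} :=
  Phi * M * p^`()^`() + (Psi * M - Phi * M^`()) * p^`()
  + (N * M^`() + (Om - N^`()) * M) * p.

(** Differentiating the first relation and multiplying by [M] leaves [q] and
  [q'] to be eliminated; the first relation gives [M q] and the second gives
  [M q']. *)
Lemma ode_of_structure (F : idomainType) (Phi Psi Om M N p q : {poly F}) :
  Phi != 0 ->
  Phi * p^`() = N * p + M * q ->
  Phi * (M * q^`() + (Psi - Phi^`() + N) * p^`() + Om * p) = 0 ->
  ode Phi Psi Om M N p = 0.
Proof.
rewrite /ode => Phi0 E /eqP; rewrite mulf_eq0 (negPf Phi0) /= => /eqP E2.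
have D : Phi * p^`()^`() = N^`() * p + N * p^`() + (M^`() * q + M * q^`())
    - Phi^`() * p^`().
  by apply/eqP; rewrite eq_sym subr_eq -!derivM -derivD -E derivM addrC.
rewrite -[RHS](mulr0 M) -E2.
have -> : Phi * M * p^`()^`() = M * (Phi * p^`()^`()) by ring.
have -> : (Psi * M - Phi * M^`()) * p^`() =
  Psi * M * p^`() - M^`() * (Phi * p^`()) by ring.
by rewrite D E; ring.
Qed.

(** The expression [ode] is linear in [M] and, for fixed [M], homogeneous in
  the four other coefficients: powers of two and constant factors of [M] can
  be cleared, even if the constant [d] is zero. *)
Lemma ode_rescale (F : fieldType) (c d : F) (Phi Psi Om M N M0 p : {poly F}) :
  c != 0 -> c *: M = d *: M0 ->
  ode (c *: Phi) (c *: Psi) (c *: Om) M0 (c *: N) p = 0 ->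
  ode Phi Psi Om M N p = 0.
Proof.
move=> c0 E E0; apply: (@mulfI _ (c ^+ 2)%:P).
  by rewrite polyC_eq0 expf_neq0.
transitivity (d%:P * ode (c *: Phi) (c *: Psi) (c *: Om) M0 (c *: N) p);
  last by rewrite E0 !mulr0.
transitivity (ode (c *: Phi) (c *: Psi) (c *: Om) (c *: M) (c *: N) p).
  by rewrite /ode !derivZ -!mul_polyC polyC_exp; ring.
by rewrite E /ode !derivZ -!mul_polyC; ring.
Qed.

(** * Chebyshev polynomials *)

(** This is [U_(n-1)], with the value at [n = 0] that the recurrence asks for,
  so that identities need no separate treatment of the index [-1]. *)
Definition Upred (F : comNzRingType) (n : nat) : {poly F} :=
  if n is m.+1 then chebU m else 0.

Lemma UpredSS (F : comNzRingType) n :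
  Upred F n.+2 = 2 * 'X * Upred F n.+1 - Upred F n.
Proof.
by case: n => [|n]; rewrite /Upred ?chebUSS /= -mul_polyC rmorph_nat; ring.
Qed.

(** The left-hand side is a Casorati determinant of two solutions of a
  recurrence with determinant one, so it does not depend on [i]. *)
Lemma Upred_cassini (F : comNzRingType) i d :
  Upred F (i + d) * Upred F i.+1 - Upred F (i + d).+1 * Upred F i = Upred F d.
Proof.
elim: i => [|i <-]; first by rewrite /= mulr1 mulr0 subr0.
by rewrite addSn !UpredSS; ring.
Qed.

Lemma deriv_Upred (F : comNzRingType) n :
  (1 - 'X^2) * (Upred F n.+1)^`()
    = - n%:R * 'X * Upred F n.+1 + n.+1%:R * Upred F n
  /\ (1 - 'X^2) * (Upred F n)^`()
    = n.+1%:R * 'X * Upred F n - n%:R * Upred F n.+1.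
Proof.
elim: n => [|n [IH1 IH0]].
  by rewrite /= derivC; split; ring.
split; last first.
  by rewrite IH1 UpredSS; ring.
rewrite [Upred F n.+2]UpredSS !poly.derivE !mulrDr mulrN IH0.
have -> : (1 - 'X^2) * (2 * 'X * (Upred F n.+1)^`())
  = 2 * 'X * ((1 - 'X^2) * (Upred F n.+1)^`()) by ring.
by rewrite IH1; ring.
Qed.

Lemma chebT_Upred (F : comNzRingType) n :
  chebT n.+1 = 'X * Upred F n.+1 - Upred F n.
Proof.
elim/ltn_ind: n => -[|[|n]] IH; [by rewrite /=; ring| |].
  by rewrite chebTSS /= -!mul_polyC !rmorph_nat; ring.
by rewrite chebTSS IH // IH // -mul_polyC rmorph_nat !UpredSS; ring.
Qed.

Lemma deriv_chebT (F : comNzRingType) n :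
  (chebT n)^`() = n%:R * Upred F n.
Proof.
elim/ltn_ind: n => -[|[|n]] IH.
- by rewrite /= derivC; ring.
- by rewrite /= derivX; ring.
rewrite chebTSS -mul_polyC rmorph_nat !poly.derivE IH // IH //.
by rewrite chebT_Upred UpredSS; ring.
Qed.

Lemma sqr_Upred (F : comNzRingType) n :
  Upred F n.+1 * Upred F n.+1
  = 2 * 'X * Upred F n.+1 * Upred F n - Upred F n * Upred F n + 1.
Proof.
have := Upred_cassini F n 1; rewrite addn1 UpredSS [Upred F 1]/=.
by move=> /eqP; rewrite subr_eq => /eqP ->; ring.
Qed.

Lemma Upred_at1 (F : comNzRingType) n : (Upred F n).[1] = n%:R.
Proof.
elim/ltn_ind: n => -[|[|n]] IH; rewrite ?hornerE //.
by rewrite UpredSS !hornerE IH // IH //; ring.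
Qed.

Lemma Upred_neq0 (F : numFieldType) n : Upred F n.+1 != 0.
Proof.
apply: contra_neq (_ : (Upred F n.+1).[1] != 0) => [->|].
  by rewrite horner0.
by rewrite Upred_at1 pnatr_eq0.
Qed.

Lemma Phi_neq0 (F : numFieldType) n : (1 - 'X^2) * Upred F n.+1 != 0.
Proof.
rewrite mulf_neq0 ?Upred_neq0 //.
apply: contra_neq (_ : (1 - 'X^2 : {poly F}).[0] != 0) => [->|].
  by rewrite horner0.
by rewrite !hornerE expr0n subr0 oner_eq0.
Qed.

(** * Gegenbauer polynomials composed with a Chebyshev polynomial *)

(** The Gegenbauer polynomials with parameter [l + 1]. *)
Fixpoint gegen (F : fieldType) (l : F) (n : nat) : {poly F} :=
  match n with
  | 0 => 1
  | 1 => (2 * (l + 1)) *: 'X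
  | (i.+1 as m).+1 =>
      m.+1%:R^-1 *: ((2 * (l + m.+1%:R)) *: ('X * gegen l m)
                     - (2 * l + m.+1%:R) *: gegen l i)
  end.

Lemma gegenSS (F : numFieldType) (l : F) n :
  n.+2%:R * gegen l n.+2 =
  2 * (l%:P + n.+2%:R) * 'X * gegen l n.+1 - (2 * l%:P + n.+2%:R) * gegen l n.
Proof.
have -> : gegen l n.+2 = n.+2%:R^-1 *: ((2 * (l + n.+2%:R)) *:
  ('X * gegen l n.+1) - (2 * l + n.+2%:R) *: gegen l n) by [].
rewrite -polyC_natr mul_polyC scalerA divff ?pnatr_eq0 // scale1r.
rewrite -!mul_polyC !(polyC_natr, polyCM, polyCD); ring.
Qed.

(** By the recurrence, the first relation at [n] and the second one at [n.+1]
  say the same about the derivative of [gegen l n.+1]; so the induction only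
  has to prove the first relation. *)
Lemma deriv_gegen (F : numFieldType) (l : F) n :
  (1 - 'X^2) * (gegen l n.+1)^`()
    = - n.+1%:R * 'X * gegen l n.+1 + (n.+2%:R + 2 * l%:P) * gegen l n
  /\ (1 - 'X^2) * (gegen l n)^`()
    = (n.+2%:R + 2 * l%:P) * 'X * gegen l n - n.+1%:R * gegen l n.+1.
Proof.
elim: n => [|n [IH1 IH0]].
  rewrite /= -mul_polyC !poly.derivE !(polyC_natr, polyCM, polyCD).
  by split; ring.
have IH2 : (1 - 'X^2) * (gegen l n.+1)^`()
    = (n.+3%:R + 2 * l%:P) * 'X * gegen l n.+1 - n.+2%:R * gegen l n.+2.
  by rewrite IH1 gegenSS; ring.
split=> //.
have nz : n.+2%:R != 0 :> {poly F} by rewrite -polyC_natr polyC_eq0 pnatr_eq0.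
apply: (mulfI nz).
have E : n.+2%:R * (gegen l n.+2)^`() = (n.+2%:R * gegen l n.+2)^`().
  by rewrite -polyC_natr !poly.derivE; ring.
rewrite mulrCA E gegenSS -!polyC_natr !poly.derivE !polyC_natr.
set a' := (gegen l n.+1)^`() in IH1 IH2 *; set b' := (gegen l n)^`() in IH0 *.
transitivity (2 * (l%:P + n.+2%:R) * ((1 - 'X^2) * gegen l n.+1
    + 'X * ((1 - 'X^2) * a')) - (2 * l%:P + n.+2%:R) * ((1 - 'X^2) * b')).
  ring.
have -> : n.+2%:R * (- n.+2%:R * 'X * gegen l n.+2
    + (n.+3%:R + 2 * l%:P) * gegen l n.+1)
  = - n.+2%:R * 'X * (n.+2%:R * gegen l n.+2)
    + n.+2%:R * ((n.+3%:R + 2 * l%:P) * gegen l n.+1) by ring.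
rewrite IH1 IH0 gegenSS; ring.
Qed.

Definition gegenT (F : fieldType) (k : nat) (l : F) (n : nat) : {poly F} :=
  gegen l n \Po chebT k.

(** The chain rule brings out [T_k' = k U_(k-1)] while [1 - T_k^2] equals
  [(1 - x^2) U_(k-1)^2], so one factor [U_(k-1)] cancels. *)
Lemma deriv_gegenT (F : numFieldType) (k : nat) (l : F) n :
  let x := 'X : {poly F} in
  let s := 1 - x ^+ 2 in
  let g := Upred F k.+1 in
  let T := x * g - Upred F k in
  s * g * (gegenT k.+1 l n.+1)^`() =
    k.+1%:R * (- n.+1%:R * T * gegenT k.+1 l n.+1
               + (n.+2%:R + 2 * l%:P) * gegenT k.+1 l n)
  /\ s * g * (gegenT k.+1 l n)^`() =
    k.+1%:R * ((n.+2%:R + 2 * l%:P) * T * gegenT k.+1 l n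
               - n.+1%:R * gegenT k.+1 l n.+1).
Proof.
move=> x s g T.
have ET : chebT k.+1 = T by exact: chebT_Upred.
have sT : 1 - T ^+ 2 = s * g ^+ 2.
  rewrite /s /T; have := sqr_Upred F k; rewrite -/g -/x => H; ring: H.
have chain q : s * g * (q \Po T)^`()
    = k.+1%:R * (((1 - 'X^2) * q^`()) \Po T).
  apply: (mulfI (Upred_neq0 F k)); rewrite -/g.
  rewrite deriv_comp -ET deriv_chebT ET -/g.
  rewrite comp_polyM comp_polyB -[1]/(1%:P) comp_polyC comp_Xn_poly.
  rewrite sT; ring.
have [H1 H0] := deriv_gegen l n.
rewrite /gegenT ET !chain H1 H0.
move: (gegen l n) (gegen l n.+1) => A B {H1 H0 chain}.
by split; rewrite !(rmorph_nat, rmorphD, rmorphB, rmorphN, rmorphM) /=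
  ?comp_polyC ?comp_polyX; ring.
Qed.

(** The index [n - 1], with the value at [n = 0] given by the recurrence. *)
Definition gegenTpred (F : fieldType) (k : nat) (l : F) (n : nat) : {poly F} :=
  if n is m.+1 then gegenT k l m else 0.

Lemma gegenT_rec (F : numFieldType) (k : nat) (l : F) n :
  n.+1%:R * gegenT k.+1 l n.+1 = 2 * (l%:P + n.+1%:R) *
   ('X * Upred F k.+1 - Upred F k) * gegenT k.+1 l n
  - (2 * l%:P + n.+1%:R) * gegenTpred k.+1 l n.
Proof.
rewrite -chebT_Upred /gegenTpred /gegenT; move: (chebT k.+1) => T.
case: n => [|n].
  rewrite /= comp_polyZ comp_polyX -[1]/(1%:P) comp_polyC -mul_polyC.
  rewrite !(polyC1, polyC_natr, polyCM, polyCD); ring.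
have := congr1 (comp_poly T) (gegenSS l n).
move: (gegen l n) (gegen l n.+1) (gegen l n.+2) => A B C.
rewrite !(rmorph_nat, rmorphD, rmorphB, rmorphN, rmorphM) /=
  ?comp_polyC ?comp_polyX => ->; ring.
Qed.

(** * The sieved polynomials *)

(** The recurrence of [qultra] after the limit; [c] is the number [m] for which
  the new index is [m k]. *)
Fixpoint sieved (F : fieldType) (k : nat) (l : F) (N : nat) : {poly F} :=
  match N with
  | 0 => 1
  | 1 => 2 *: 'X
  | (i.+1 as m).+1 =>
      if (k %| m.+1)%N then
        let c := (m.+1 %/ k)%N%:R in
        (2 * (l + c) / c) *: ('X * sieved k l m)
        - ((2 * l + c) / c) *: sieved k l i
      else 2 *: ('X * sieved k l m) - sieved k l i
  end.

Lemma sievedE (F : fieldType) (k : nat) (l : F) N (c := (N.+2 %/ k)%N%:R) :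
  sieved k l N.+2 = if (k %| N.+2)%N
    then (2 * (l + c) / c) *: ('X * sieved k l N.+1)
         - ((2 * l + c) / c) *: sieved k l N
    else 2 *: ('X * sieved k l N.+1) - sieved k l N.
Proof. by []. Qed.

Lemma sieved_ndvd (F : fieldType) (k : nat) (l : F) N : ~~ (k %| N.+2)%N ->
  sieved k l N.+2 = 2 * 'X * sieved k l N.+1 - sieved k l N.
Proof.
by move=> /negPf h; rewrite sievedE h -mul_polyC polyC_natr mulrA.
Qed.

Lemma sieved_mul (F : numFieldType) (k : nat) (l : F) n :
  n.+1%:R * sieved k.+2 l (n.+1 * k.+2) =
  2 * (l%:P + n.+1%:R) * 'X * sieved k.+2 l (n * k.+2 + k.+1)
  - (2 * l%:P + n.+1%:R) * sieved k.+2 l (n * k.+2 + k).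
Proof.
have h : (n.+1 * k.+2 = (n * k.+2 + k).+2)%N by rewrite mulSn addnC !addnS.
rewrite h sievedE -h dvdn_mull // mulnK // addnS.
have nz : n.+1%:R != 0 :> F by rewrite pnatr_eq0.
rewrite -polyC_natr mul_polyC scalerBr !scalerA !(mulrC n.+1%:R) !divfK //.
rewrite -!mul_polyC !(polyC_natr, polyCM, polyCD); ring.
Qed.

(** Inside a block both sides follow the Chebyshev recurrence, so two initial
  values decide. At a multiple of [k] the term [U_(k-2) G_(n-1)(T_k)] of the
  new block and the identity [T_k = x U_(k-1) - U_(k-2)] turn the sieved
  recurrence into the recurrence of [G_n] at [T_k]. *)
Lemma sieved_gegenT (F : numFieldType) (k : nat) (l : F) n j : (j < k.+2)%N ->
  sieved k.+2 l (n * k.+2 + j)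
  = Upred F j.+1 * gegenT k.+2 l n + Upred F (k.+1 - j) * gegenTpred k.+2 l n.
Proof.
have nd i m : (0 < i < k.+2)%N -> ~~ (k.+2 %| m * k.+2 + i)%N.
  by move=> /andP[i0 ik]; rewrite dvdn_addr ?dvdn_mull // gtnNdvd.
pose P m := sieved k.+2 l (m * k.+2) = gegenT k.+2 l m
  + Upred F k.+1 * gegenTpred k.+2 l m.
pose Q m := sieved k.+2 l (m * k.+2 + 1) = 2 * 'X * gegenT k.+2 l m
  + Upred F k * gegenTpred k.+2 l m.
have block m : P m -> Q m -> forall i, (i < k.+2)%N ->
  sieved k.+2 l (m * k.+2 + i)
  = Upred F i.+1 * gegenT k.+2 l m + Upred F (k.+1 - i) * gegenTpred k.+2 l m.
  move=> Pm Qm; elim/ltn_ind => -[|[|i]] IH ik.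
  - by rewrite addn0 subn0 mul1r.
  - by rewrite subSS subn0 Qm UpredSS subr0 /= mulr1.
  have ik' : (i < k.+2)%N by rewrite (ltn_trans _ ik) // ltnW.
  rewrite !addnS sieved_ndvd -?addnS ?nd // IH // ?(ltnW ik) // IH //.
  rewrite [Upred F i.+3]UpredSS.
  have -> : (k.+1 - i = (k.+1 - i.+2).+2)%N.
    by rewrite -subSn // -subSn ?(ltnW ik).
  have -> : (k.+1 - i.+1 = (k.+1 - i.+2).+1)%N.
    by rewrite -subSn.
  by rewrite [Upred F (k.+1 - i.+2).+2]UpredSS; ring.
suff PQ m : P m /\ Q m by move=> jk; have [] := PQ n => Pn Qn; exact: block.
elim: m => [|m [Pm Qm]].
  rewrite /P /Q /= !mulr0 !addr0 /gegenT -[1]/(1%:P) comp_polyC mulr1.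
  by rewrite -mul_polyC polyC_natr.
have b := block m Pm Qm.
have PS : P m.+1.
  have nz : m.+1%:R != 0 :> {poly F}.
    by rewrite -polyC_natr polyC_eq0 pnatr_eq0.
  apply: (mulfI nz); rewrite sieved_mul !b // [RHS]mulrDr gegenT_rec.
  rewrite subnn subSnn [Upred F 0]/= [Upred F 1]/= [gegenTpred _ _ m.+1]/=.
  by ring.
split=> //; rewrite /Q.
have h : (m.+1 * k.+2 + 1 = (m * k.+2 + k.+1).+2)%N.
  by rewrite mulSn addn1 addnC !addnS.
have h1 : ((m * k.+2 + k.+1).+1 = m.+1 * k.+2)%N.
  by symmetry; rewrite mulSn addnC !addnS.
rewrite h sieved_ndvd -?h ?nd // h1 PS b // subnn [Upred F 0]/= UpredSS.
by rewrite [gegenTpred _ _ m.+1]/=; ring.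
Qed.

(** * Coefficients with the powers of two cleared *)

Lemma exp2_neq0 (F : numFieldType) m : 2 ^+ m != 0 :> F.
Proof. by rewrite expf_neq0 // pnatr_eq0. Qed.

Lemma hatUE (F : numFieldType) n : hatU n%:Z = 2 ^- n *: Upred F n.+1.
Proof. by []. Qed.

Lemma hatU_pred (F : numFieldType) n :
  hatU (n%:Z - 1) = (2 / 2 ^+ n) *: Upred F n.
Proof.
case: n => [|n]; first by rewrite scaler0.
have -> : n.+1%:Z - 1 = n by rewrite -addn1 PoszD addrK.
rewrite hatUE; congr (_ *: _); rewrite exprS; field.
by rewrite exp2_neq0.
Qed.

Lemma hatU_kB1 (F : numFieldType) k :
  hatU (k.+2%:Z - 1) = (2 ^+ k.+1)^-1 *: Upred F k.+2.
Proof. by rewrite -hatUE; congr hatU; lia. Qed.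

Lemma hatU_kB2 (F : numFieldType) k :
  hatU (k.+2%:Z - 2) = (2 / 2 ^+ k.+1) *: Upred F k.+1.
Proof. by rewrite -hatU_pred; congr hatU; lia. Qed.

Lemma hatT_k (F : numFieldType) k :
  hatT k.+2 = (2 ^+ k.+1)^-1 *: ('X * Upred F k.+2 - Upred F k.+1).
Proof. by rewrite /hatT chebT_Upred. Qed.

Lemma scaled_Phi (F : numFieldType) k :
  2 ^+ k.+1 *: odePhi F k.+2 = (1 - 'X^2) * Upred F k.+2.
Proof.
by rewrite /odePhi hatU_kB1 -scalerAr scalerA divff ?exp2_neq0 // scale1r.
Qed.

Lemma scaled_Psi (F : numFieldType) (l : F) k :
  2 ^+ k.+1 *: odePsi k.+2 l
  = - (2 * 'X * Upred F k.+2
       + k.+2%:R * (2 * l%:P + 1) * ('X * Upred F k.+2 - Upred F k.+1)).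
Proof.
rewrite /odePsi hatU_kB1 hatT_k -!scalerAr scalerN scalerDr !scalerA.
congr (- _); transitivity (2 *: ('X * Upred F k.+2)
  + (k.+2%:R * (2 * l + 1)) *: ('X * Upred F k.+2 - Upred F k.+1)).
  by congr (_ *: _ + _ *: _); field; rewrite !exp2_neq0.
by rewrite -!mul_polyC !(polyC_natr, polyC1, polyCN, polyCM, polyCD); ring.
Qed.

(** * Indices before the last one of a block *)

(** The period is [k + 2 = j + e + 2], where [j <= k] is the position in the
  block. *)
Section InsideBlock.
Variables (F : numFieldType) (l : F) (n j e : nat).
Let k := (j + e)%N.
Let N := (n.+1 * k.+2 + j)%N.
Let x : {poly F} := 'X.
Let L := l%:P.
Let K : {poly F} := k.+2%:R.
Let u := Upred F j.+1.
Let w := Upred F j.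
Let g := Upred F k.+2.
Let h := Upred F k.+1.
Let v := Upred F e.+1.
Let r := Upred F e.

Lemma hatU_kBjB2 : hatU (k.+2%:Z - j%:Z - 2) = (2 ^+ e)^-1 *: v.
Proof. by rewrite -hatUE; congr hatU; rewrite /k; lia. Qed.

Lemma hatU_kBjB3 : hatU (k.+2%:Z - j%:Z - 3) = (2 / 2 ^+ e) *: r.
Proof. by rewrite -hatU_pred; congr hatU; rewrite /k; lia. Qed.

Lemma scaled_M : 2 ^+ k.+1 *: odeM k.+2 l n.+1 j
  = 2 * (- (N%:R + 1 + L * K) * g - L * K * (w * v - u * r)).
Proof.
rewrite /odeM hatU_kB1 hatU_kBjB3 hatU_kBjB2 hatU_pred hatUE -/u -/w -/N.
rewrite -!scalerAl -!scalerAr !scalerA !scalerBr !scalerA !opprB.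
transitivity ((- (2 * (N%:R + 1 + l * k.+2%:R))) *: g
   + ((2 * l * k.+2%:R) *: (u * r) - (2 * l * k.+2%:R) *: (w * v))).
  by congr (_ *: _ + (_ *: _ - _ *: _)); rewrite ?exprS ?exprD; field;
    rewrite !exp2_neq0.
by rewrite -!mul_polyC !(polyC_natr, polyC1, polyCN, polyCM, polyCD); ring.
Qed.

Lemma scaled_Om : 2 ^+ k.+1 *: odeOmega k.+2 l n.+1 j
  = (N%:R + 1) * (N%:R + 2 + 2 * L * K) * g - 2 * L * K * (u * r).
Proof.
rewrite /odeOmega hatU_kB1 hatU_kBjB3 hatUE -/u -/N.
rewrite -!scalerAl -!scalerAr !scalerA !scalerBr !scalerA.
transitivity (((N%:R + 1) * (N%:R + 2 + 2 * l * k.+2%:R)) *: g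
   - (2 * l * k.+2%:R) *: (u * r)).
  by congr (_ *: _ - _ *: _); rewrite ?exprS ?exprD; field;
    rewrite !exp2_neq0.
by rewrite -!mul_polyC !(polyC_natr, polyC1, polyCN, polyCM, polyCD); ring.
Qed.

(** For [e = 0] the convention [hatU (- 2) = 0] drops a term that the
  recurrence would keep, and [eps] drops the term that it would have
  cancelled; so one formula covers both values of [eps]. *)
Lemma scaled_Ntail :
  2 ^+ k.+1 *: ((l * k.+2%:R * eps F k.+2 j) *: hatU (k.+2%:Z - 2)
    + (l * k.+2%:R / 8) *: (hatU j%:Z * hatU (k.+2%:Z - j%:Z - 4)))
  = L * K * (h + u * (2 * x * r - v)).
Proof.
rewrite hatU_kB2 hatUE -/u /eps.
have -> : (j == k.+2 - 1)%N = false by rewrite /k; lia.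
have -> : (j == k.+2 - 2)%N = (e == 0%N) by rewrite /k; lia.
rewrite /h /v /r /K /k; case: e => [|e'].
  have -> : (j + 0).+2%:Z - j%:Z - 4 = Negz 1 by lia.
  rewrite [hatU _]/= [Upred F 0]/= [Upred F 1]/= addn0 eqxx -/u.
  by rewrite mulr0 scale0r mulr0 !scaler0; ring.
have -> : (j + e'.+1).+2%:Z - j%:Z - 4 = e'%:Z - 1 by lia.
have -> : (e'.+1 == 0)%N = false by [].
rewrite hatU_pred UpredSS -!scalerAl -!scalerAr scalerDr !scalerA.
transitivity ((l * (j + e'.+1).+2%:R) *: Upred F (j + e'.+1).+1
   + (l * (j + e'.+1).+2%:R) *: (u * Upred F e')).
  by congr (_ *: _ + _ *: _); rewrite ?exprS ?exprD ?exprS; field;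
    rewrite !exp2_neq0.
by rewrite -!mul_polyC !(polyC_natr, polyC1, polyCN, polyCM, polyCD) /x; ring.
Qed.

Lemma scaled_N : 2 ^+ k.+1 *: odeN k.+2 l n.+1 j
  = (N%:R + 2 + 2 * L * K) * x * g - L * K * h
    + L * K * (w * r - u * (2 * x * r - v)).
Proof.
have -> : odeN k.+2 l n.+1 j
  = (N%:R + 2 + 2 * l * k.+2%:R) *: (x * hatU (k.+2%:Z - 1))
  + (l * k.+2%:R / 8) *: (hatU (j%:Z - 1) * hatU (k.+2%:Z - j%:Z - 3))
  - ((l * k.+2%:R * eps F k.+2 j) *: hatU (k.+2%:Z - 2)
    + (l * k.+2%:R / 8) *: (hatU j%:Z * hatU (k.+2%:Z - j%:Z - 4))).
  rewrite /odeN scalerBr -/N -/x.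
  by move: (_ *: _) (_ *: _) (_ *: _) (_ *: _) => *; ring.
rewrite scalerBr scaled_Ntail hatU_kB1 hatU_kBjB3 hatU_pred -/u -/w.
rewrite -!scalerAl -!scalerAr scalerDr !scalerA.
transitivity ((N%:R + 2 + 2 * l * k.+2%:R) *: (x * g)
   + (l * k.+2%:R) *: (w * r) - L * K * (h + u * (2 * x * r - v))).
  by congr (_ *: _ + _ *: _ - _); rewrite ?exprS ?exprD; field;
    rewrite !exp2_neq0.
by rewrite -!mul_polyC !(polyC_natr, polyC1, polyCN, polyCM, polyCD); ring.
Qed.

Let s : {poly F} := 1 - x ^+ 2.
Let a := gegenT k.+2 l n.+1.
Let b := gegenT k.+2 l n.
Let p := u * a + v * b.
Let q := (2 * x * u - w) * a + r * b.

Lemma cofactor_v : v = h * u - g * w.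
Proof. by rewrite /v -(Upred_cassini F j) addnS. Qed.

Lemma cofactor_r : r = h * (2 * x * u - w) - g * u.
Proof.
by rewrite /r -(Upred_cassini F j.+1) !addSn -/k -/g -/h UpredSS -/u -/w.
Qed.

(** Here [q] is the next sieved polynomial, in the same block. *)
Lemma structure_inside :
  let Phi := s * g in
  let M := - (n.+1%:R * K + j%:R + 1 + L * K) * g - L * K * (w * v - u * r) in
  let NN := (n.+1%:R * K + j%:R + 2 + 2 * L * K) * x * g - L * K * h
    + L * K * (w * r - u * (2 * x * r - v)) in
  let Om := (n.+1%:R * K + j%:R + 1) * (n.+1%:R * K + j%:R + 2 + 2 * L * K) * g
    - 2 * L * K * (u * r) in
  let Psi := - (2 * x * g + K * (2 * L + 1) * (x * g - h)) in
  Phi * p^`() = NN * p + M * q /\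
  Phi * (M * q^`() + (Psi - Phi^`() + NN) * p^`() + Om * p) = 0.
Proof.
move=> Phi M NN Om Psi.
have [su sw] : s * u^`() = - j%:R * x * u + (j%:R + 1) * w /\
   s * w^`() = (j%:R + 1) * x * w - j%:R * u.
  have [-> ->] := deriv_Upred F j; split; rewrite -/u -/w -/x; ring.
have sg : s * g^`() = - (K - 1) * x * g + K * h.
  by have [-> _] := deriv_Upred F k.+1; rewrite -/g -/h -/x /K; ring.
have [sv sr] : s * v^`() = - (K - j%:R - 2) * x * v + (K - j%:R - 1) * r /\
   s * r^`() = (K - j%:R - 1) * x * r - (K - j%:R - 2) * v.
  have [-> ->] := deriv_Upred F e; rewrite -/v -/r -/x.
  have -> : K = e%:R + j%:R + 2 by rewrite /K /k -!natrD; congr _%:R; lia.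
  by split; ring.
have [sa sb] := deriv_gegenT k.+1 l n.
rewrite -/a -/b -/g -/h -/x -/s -/K -/L in sa sb.
have dp : Phi * p^`() = g * ((s * u^`()) * a + (s * v^`()) * b)
    + u * (s * g * a^`()) + v * (s * g * b^`()).
  by rewrite /p !poly.derivE /Phi; ring.
have dq : Phi * q^`() = g * ((2 * s * u + 2 * x * (s * u^`()) - s * w^`()) * a
    + (s * r^`()) * b) + (2 * x * u - w) * (s * g * a^`())
    + r * (s * g * b^`()).
  by rewrite /q !poly.derivE /Phi -/x; ring.
have dPhi : Phi^`() = - 2 * x * g + s * g^`().
  by rewrite /Phi /s !poly.derivE -/x; ring.
rewrite su sv sa sb in dp; rewrite su sw sr sa sb in dq.
rewrite sg in dPhi.
have Hv := cofactor_v; have Hr := cofactor_r.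
have Hu : u * u = 2 * x * u * w - w * w + 1 := sqr_Upred F j.
have Hg : g * g = 2 * x * g * h - h * h + 1 := sqr_Upred F k.+1.
have -> : Phi * (M * q^`() + (Psi - Phi^`() + NN) * p^`() + Om * p)
  = M * (Phi * q^`()) + (Psi - Phi^`() + NN) * (Phi * p^`()) + Phi * Om * p.
  by ring.
rewrite dp dq dPhi /M /NN /Om /Psi /Phi /p /q Hv Hr.
move: su sw sg sv sr sa sb dp dq dPhi Hv Hr => _ _ _ _ _ _ _ _ _ _ _ _.
clear -Hu Hg.
have -> : s = 1 - x ^+ 2 by [].
(* The leading monomials [u^2] and [g^2] are coprime, so rewriting with the
   two quadratic relations is a complete reduction. *)
move: a b K L u w g h x (j%:R : {poly F}) Hu Hg.
move=> a1 b1 K1 L1 u1 w1 g1 h1 x1 J1 {}Hu {}Hg.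
by split; ring: Hu Hg.
Qed.

Lemma inside_block_ode :
  let P := sieved k.+2 l (n.+1 * k.+2 + j) in
  ode (odePhi F k.+2) (odePsi k.+2 l) (odeOmega k.+2 l n.+1 j)
    (odeM k.+2 l n.+1 j) (odeN k.+2 l n.+1 j) P = 0.
Proof.
move=> P; have -> : P = p.
  rewrite /P sieved_gegenT; last by rewrite /k; lia.
  by have -> : (k.+1 - j = e.+1)%N by rewrite /k; lia.
have E0 : (n.+1 * k.+2 + j)%N%:R = n.+1%:R * K + j%:R :> {poly F}.
  by rewrite natrD natrM.
pose M := - (n.+1%:R * K + j%:R + 1 + L * K) * g - L * K * (w * v - u * r).
have EM : 2 ^+ k.+1 *: odeM k.+2 l n.+1 j = 2 *: M.
  by rewrite scaled_M E0 -mul_polyC polyC_natr.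
apply: (ode_rescale (exp2_neq0 F k.+1) EM).
rewrite scaled_Phi scaled_Psi scaled_Om scaled_N E0.
have [S1 S2] := structure_inside.
apply: ode_of_structure S1 S2; exact: Phi_neq0.
Qed.
End InsideBlock.

(** * The last index of a block *)

(** For [j = k - 1] the sieved polynomial is [U_(k-1) G_n(T_k)]. The products in
  [odeM] vanish by convention, so that [odeM] is a constant times [U_(k-1)];
  the relations are proved for [M = U_(k-1)] itself, with [q] scaled
  accordingly, so that the constant is allowed to vanish. *)
Section BlockEnd.
Variables (F : numFieldType) (l : F) (n k : nat).
Let N := (n.+1 * k.+2 + k.+1)%N.
Let x : {poly F} := 'X.
Let L := l%:P.
Let K : {poly F} := k.+2%:R.
Let g := Upred F k.+2.
Let h := Upred F k.+1.

Lemma hatU_end z : (0 < z)%N ->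
  hatU (k.+2%:Z - k.+1%:Z - z.+1%:Z) = 0 :> {poly F}.
Proof.
by case: z => // z _; have -> : k.+2%:Z - k.+1%:Z - z.+2%:Z = Negz z by lia.
Qed.

Lemma end_M : 2 ^+ k.+1 *: odeM k.+2 l n.+1 k.+1
  = (- (2 * (N%:R + 1 + l * k.+2%:R))) *: g.
Proof.
rewrite /odeM -/N hatU_kB1 !hatU_end // !mulr0 subrr scaler0 subr0 !scalerA.
by congr (_ *: _); field; rewrite exp2_neq0.
Qed.

Lemma end_Om : 2 ^+ k.+1 *: odeOmega k.+2 l n.+1 k.+1
  = (N%:R + 1) * (N%:R + 2 + 2 * L * K) * g.
Proof.
rewrite /odeOmega -/N hatU_kB1 !hatU_end // !mulr0 scaler0 subr0 !scalerA.
transitivity (((N%:R + 1) * (N%:R + 2 + 2 * l * k.+2%:R)) *: g).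
  by congr (_ *: _); field; rewrite exp2_neq0.
by rewrite -!mul_polyC !(polyC_natr, polyC1, polyCN, polyCM, polyCD); ring.
Qed.

Lemma end_N : 2 ^+ k.+1 *: odeN k.+2 l n.+1 k.+1
  = (N%:R + 2 + 2 * L * K) * x * g - 2 * L * K * h.
Proof.
rewrite /odeN -/N hatU_kB1 hatU_kB2 !hatU_end //.
rewrite !mulr0 subrr scaler0 addr0 /eps.
have -> : (k.+1 == k.+2 - 1)%N by apply/eqP; lia.
rewrite -!scalerAr scalerBr !scalerA.
transitivity ((N%:R + 2 + 2 * l * k.+2%:R) *: (x * g) - (2 * l * k.+2%:R) *: h).
  by congr (_ *: _ - _ *: _); field; rewrite !exp2_neq0.
by rewrite -!mul_polyC !(polyC_natr, polyC1, polyCN, polyCM, polyCD); ring.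
Qed.

Let s : {poly F} := 1 - x ^+ 2.
Let a := gegenT k.+2 l n.+1.
Let b := gegenT k.+2 l n.
Let p := g * a.
Let m : {poly F} := n.+2%:R.
Let q := - ((2 * K * (m + L)) * x * g - (m * K + 2 * L * K) * h) * a
  + K * (m + 2 * L) * b.

(** Here [q] is [- K m] times the next sieved polynomial, the first one of the
  next block. *)
Lemma structure_end :
  let NN : {poly F} := n.+1%:R * K + K - 1 in
  let Phi := s * g in
  let M := g in
  let N0 := (NN + 2 + 2 * L * K) * x * g - 2 * L * K * h in
  let Om := (NN + 1) * (NN + 2 + 2 * L * K) * g in
  let Psi := - (2 * x * g + K * (2 * L + 1) * (x * g - h)) in
  Phi * p^`() = N0 * p + M * q /\
  Phi * (M * q^`() + (Psi - Phi^`() + N0) * p^`() + Om * p) = 0.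
Proof.
move=> NN Phi M N0 Om Psi.
have [sg sh] : s * g^`() = - (K - 1) * x * g + K * h /\
   s * h^`() = K * x * h - (K - 1) * g.
  by have [-> ->] := deriv_Upred F k.+1; split; rewrite // -/g -/h -/x /K; ring.
have [sa sb] := deriv_gegenT k.+1 l n.
rewrite -/a -/b -/g -/h -/x -/s -/K -/L in sa sb.
have dp : Phi * p^`() = g * ((s * g^`()) * a) + g * (s * g * a^`()).
  by rewrite /p !poly.derivE /Phi; ring.
have dq : Phi * q^`() = - ((2 * K * (m + L)) * (s * g + x * (s * g^`()))
    - (m * K + 2 * L * K) * (s * h^`())) * g * a
  - ((2 * K * (m + L)) * x * g - (m * K + 2 * L * K) * h) * (s * g * a^`())
  + K * (m + 2 * L) * (s * g * b^`()).
  by rewrite /q /K /m -!polyC_natr !poly.derivE /Phi -/x; ring.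
have dPhi : Phi^`() = - 2 * x * g + s * g^`().
  by rewrite /Phi /s !poly.derivE -/x; ring.
rewrite sg sa in dp; rewrite sg sh sa sb in dq; rewrite sg in dPhi.
have Hg : g * g = 2 * x * g * h - h * h + 1 := sqr_Upred F k.+1.
have -> : Phi * (M * q^`() + (Psi - Phi^`() + N0) * p^`() + Om * p)
  = M * (Phi * q^`()) + (Psi - Phi^`() + N0) * (Phi * p^`()) + Phi * Om * p.
  by ring.
rewrite dp dq dPhi /M /N0 /Om /NN /Psi /Phi /p /q.
have -> : s = 1 - x ^+ 2 by [].
have -> : m = n.+1%:R + 1 by rewrite /m; ring.
move: a b K L g h x Hg => a1 b1 K1 L1 g1 h1 x1 {}Hg.
by split; ring: Hg.
Qed.

Lemma block_end_ode :
  let P := sieved k.+2 l (n.+1 * k.+2 + k.+1) in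
  ode (odePhi F k.+2) (odePsi k.+2 l) (odeOmega k.+2 l n.+1 k.+1)
    (odeM k.+2 l n.+1 k.+1) (odeN k.+2 l n.+1 k.+1) P = 0.
Proof.
move=> P; have -> : P = p.
  by rewrite /P sieved_gegenT // subnn [Upred F 0]/= mul0r addr0.
have E0 : (n.+1 * k.+2 + k.+1)%N%:R = n.+1%:R * K + K - 1 :> {poly F}.
  by rewrite natrD natrM /K; ring.
apply: (ode_rescale (exp2_neq0 F k.+1) end_M).
rewrite scaled_Phi scaled_Psi end_Om end_N E0.
have [S1 S2] := structure_end.
apply: ode_of_structure S1 S2; exact: Phi_neq0.
Qed.
End BlockEnd.

(** * Left limits at 1 *)

Section LeftLimits.
Import numFieldNormedType.Exports.
Local Open Scope classical_set_scope.
Local Open Scope complex_scope.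

(** The cast selects the topology that the modulus induces on the complex
  numbers. *)
Definition tends1 (R : realType) (f : R -> R[i]) (l : R[i]) : Prop :=
  (f s : (R[i] : numFieldType)) @[s --> (1 : R)^'-]
    --> (l : (R[i] : numFieldType)).

Lemma tends1_ext (R : realType) (f g : R -> R[i]) (l : R[i]) :
  tends1 f l -> (forall s, 0 < s < 1 -> f s = g s) -> tends1 g l.
Proof.
move=> fl fg; apply: cvg_trans fl; apply: near_eq_cvg; near=> s; apply: fg.
by apply/andP; split; near: s; [exact: nbhs_left_gt|exact: nbhs_left_lt].
Unshelve. all: by end_near. Qed.

Lemma tends1_cst (R : realType) (c : R[i]) : tends1 (fun _ : R => c) c.
Proof. exact: cvg_cst. Qed.
Arguments tends1_cst {R} c.

Lemma tends1D (R : realType) (f g : R -> R[i]) (l m : R[i]) :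
  tends1 f l -> tends1 g m -> tends1 (fun s => f s + g s) (l + m).
Proof. exact: cvgD. Qed.

Lemma tends1B (R : realType) (f g : R -> R[i]) (l m : R[i]) :
  tends1 f l -> tends1 g m -> tends1 (fun s => f s - g s) (l - m).
Proof. exact: cvgB. Qed.

Lemma tends1M (R : realType) (f g : R -> R[i]) (l m : R[i]) :
  tends1 f l -> tends1 g m -> tends1 (fun s => f s * g s) (l * m).
Proof. exact: cvgM. Qed.

Lemma tends1V (R : realType) (f : R -> R[i]) (l : R[i]) :
  l != 0 -> tends1 f l -> tends1 (fun s => (f s)^-1) l^-1.
Proof. exact: cvgV. Qed.

Lemma tends1_real (R : realType) (f : R -> R) (l : R) :
  f s @[s --> (1 : R)^'-] --> l -> tends1 (fun s => (f s)%:C) l%:C.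
Proof.
move=> /cvgrPdist_lt fl; apply/cvgrPdist_lt => -[e e'] /=.
rewrite ltcE /= => /andP[/eqP -> e0].
near=> x.
rewrite -rmorphB normc_def /= expr0n /= addr0 sqrtr_sqr ltcR.
by near: x; exact: fl.
Unshelve. all: by end_near. Qed.

Lemma cvg_difference_quotient (R : realType) (f : R -> R) (df : R) :
  is_derive (1 : R) 1 f df ->
  (f s - f 1) / (s - 1) @[s --> (1 : R)^'-] --> df.
Proof.
case=> H <-; rewrite /derivable in H; rewrite /derive.
have sub : (s - 1) @[s --> (1 : R)^'-] --> (0 : R)^'.
  move=> A /nbhs_ballP [e /= e0 eA]; exists e => //= s es s1.
  apply: eA; last by rewrite subr_eq0 lt_eqF.
  by move: es; rewrite /ball /= sub0r normrN distrC.
have := cvg_comp _ _ sub H.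
apply: cvg_trans; apply: near_eq_cvg; near=> s => /=.
by rewrite /GRing.scale /= mulr1 subrK mulrC.
Unshelve. all: by end_near. Qed.

Lemma cpowRE (R : realType) (s : R) (a : R[i]) :
  cpowR s a = (expR (complex.Re a * ln s) * cos (complex.Im a * ln s))%:C
   + 'i%C * (expR (complex.Re a * ln s) * sin (complex.Im a * ln s))%:C.
Proof.
case: a => a b; rewrite /cpowR /cexp.
have -> : (a +i* b) * (ln s)%:C = (a * ln s) +i* (b * ln s).
  by simpc.
by simpc.
Qed.

(** The function [s ^ a] has derivative [a] at [1], read off from the
  derivatives of its real and imaginary parts. *)
Lemma tends1_cpowR_slope (R : realType) (a : R[i]) :
  tends1 (fun s => (1 - cpowR s a) / (1 - s)%:C) a.
Proof.
set u := fun s : R => expR (complex.Re a * ln s) * cos (complex.Im a * ln s).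
set v := fun s : R => expR (complex.Re a * ln s) * sin (complex.Im a * ln s).
have dl c : is_derive (1 : R) 1 (fun s => c * ln s) c.
  have l1 : is_derive (1 : R) 1 (@ln R) (1^-1) by exact: is_derive1_ln.
  have := is_deriveZ c l1.
  by rewrite invr1 /GRing.scale /= mulr1.
have [da db] := (dl (complex.Re a), dl (complex.Im a)).
have de := @is_derive1_comp _ expR _ _ _ _ (is_derive_expR _) da.
have dc := @is_derive1_comp _ cos _ _ _ _ (is_derive_cos _) db.
have ds := @is_derive1_comp _ sin _ _ _ _ (is_derive_sin _) db.
have du : is_derive (1 : R) 1 u (complex.Re a).
  have := is_deriveM de dc; rewrite /= ln1 !mulr0 expR0 cos0 sin0 oppr0 mul0r.
  by rewrite scaler0 add0r mul1r [_ *: _]mul1r.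
have dv : is_derive (1 : R) 1 v (complex.Im a).
  have := is_deriveM de ds; rewrite /= ln1 !mulr0 expR0 cos0 sin0.
  by rewrite scale0r addr0 mul1r [_ *: _]mul1r.
rewrite [X in tends1 _ X]complexE.
have [Hu Hv] := (cvg_difference_quotient du, cvg_difference_quotient dv).
have H := (tends1D (tends1_real Hu)
  (tends1M (tends1_cst 'i%C) (tends1_real Hv))).
apply: (tends1_ext H) => s /andP[_ s1].
have -> : 1 - cpowR s a = - ((u s - u 1)%:C + 'i%C * (v s - v 1)%:C).
  rewrite cpowRE -/(u s) -/(v s) /u /v ln1 !mulr0 expR0 cos0 sin0 !mulr1 mulr0.
  by rewrite !rmorphB rmorph1 rmorph0; ring.
have -> : (1 - s)%:C = - (s - 1)%:C by rewrite -rmorphN opprB.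
by rewrite invrN mulrNN !rmorphM !fmorphV mulrA -mulrDl.
Qed.

Arguments tends1_cpowR_slope {R} a.

Lemma real_complex_1B_neq0 (R : realType) (s : R) : s < 1 -> (1 - s)%:C != 0.
Proof. by move=> s1; rewrite fmorph_eq0 subr_eq0 gt_eqF. Qed.

Lemma tends1_cpowR (R : realType) (a : R[i]) : tends1 (fun s => cpowR s a) 1.
Proof.
have H0 : tends1 (fun s : R => (1 - s)%:C) 0%:C.
  apply: tends1_real; rewrite -(subrr (1 : R)).
  by apply: cvgB; [exact: cvg_cst|exact: cvg_at_left_filter].
have := tends1B (tends1_cst 1) (tends1M (tends1_cpowR_slope a) H0).
rewrite rmorph0 mulr0 subr0 => /tends1_ext; apply=> s /andP[_ s1].
by rewrite divfK ?subKr // real_complex_1B_neq0.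
Qed.

Arguments tends1_cpowR {R} a.

Lemma tends1_cpowR_ratio (R : realType) (a b : R[i]) : b != 0 ->
  tends1 (fun s => (1 - cpowR s a) / (1 - cpowR s b)) (a / b).
Proof.
move=> b0.
have := tends1M (tends1_cpowR_slope a) (tends1V b0 (tends1_cpowR_slope b)).
move=> /tends1_ext; apply=> s /andP[_ s1].
by rewrite invf_div mulrA divfK // real_complex_1B_neq0.
Qed.

Arguments tends1_cpowR_ratio {R} a [b].

(** * The limit of the q-recurrence *)

Lemma cexpD (R : realType) (a b : R[i]) : cexp (a + b) = cexp a * cexp b.
Proof.
case: a b => [a b] [c d]; rewrite /cexp /=.
rewrite expRD cosD sinD; simpc; congr (_ +i* _); ring.
Qed.

Lemma cpowRD (R : realType) (s : R) (a b : R[i]) :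
  cpowR s (a + b) = cpowR s a * cpowR s b.
Proof. by rewrite /cpowR mulrDl cexpD. Qed.

Lemma cexpMn (R : realType) (a : R[i]) n : cexp (a *+ n) = cexp a ^+ n.
Proof.
elim: n => [|n IH]; last by rewrite mulrS cexpD IH exprS.
by rewrite /cexp /= expR0 cos0 sin0 mul1r.
Qed.

Lemma cpowR_nat (R : realType) (s : R) n : 0 < s -> cpowR s n%:R = s%:C ^+ n.
Proof.
move=> s0; rewrite /cpowR mulr_natl cexpMn; congr (_ ^+ _).
by rewrite /cexp /= lnK ?posrE // cos0 sin0 complexr0 rmorph1 mulr1.
Qed.

Lemma omega_expE (R : realType) k m : (omega k : R[i]) ^+ m
  = (cos (2 * pi / k%:R * m%:R)) +i* (sin (2 * pi / k%:R * m%:R)).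
Proof.
rewrite /omega -cexpMn.
have -> : (2 * pi / k%:R)*i *+ m = 0 +i* (2 * pi / k%:R * m%:R) :> R[i].
  elim: m => [|m IH]; first by rewrite mulr0n mulr0.
  rewrite mulrSr IH; simpc; congr (_ +i* _).
  by rewrite -[m.+1%:R]natr1 [RHS]mulrDr mulr1.
by rewrite /cexp /= expR0 mul1r.
Qed.

Lemma omega_expk (R : realType) k : (0 < k)%N -> (omega k : R[i]) ^+ k = 1.
Proof.
move=> k0; rewrite omega_expE divfK ?pnatr_eq0 -?lt0n //.
by rewrite mulr_natl cos2pi sin2pi.
Qed.

Lemma omega_exp_neq1 (R : realType) k m : (0 < k)%N -> ~~ (k %| m)%N ->
  (omega k : R[i]) ^+ m != 1.
Proof.
move=> k0; rewrite (divn_eq m k) mulnC dvdn_addr ?dvdn_mulr // => mk.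
rewrite exprD exprM omega_expk // expr1n mul1r omega_expE.
(* For half of the angle, [cos (2 y) = 1] would force [sin y = 0], but [y]
   lies strictly between [0] and [pi]. *)
set y : R := pi / k%:R * (m %% k)%:R.
have -> : 2 * pi / k%:R * (m %% k)%:R = y *+ 2 by rewrite /y -mulr_natl; ring.
have m0 : (0 < m %% k)%N by rewrite lt0n; apply: contra mk => /eqP ->.
have sy : 0 < sin y.
  have kR : 0 < k%:R :> R by rewrite ltr0n.
  rewrite sin_gt0_pi // /y mulrAC -mulrA mulr_gt0 ?pi_gt0 ?divr_gt0 ?ltr0n //=.
  by rewrite mulrC gtr_pMl ?pi_gt0 // ltr_pdivrMr // mul1r ltr_nat ltn_mod.
apply/eqP => -[]; rewrite cos_mulr2n => E _.
have : sin y ^+ 2 = 0.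
  have := cos2Dsin2 y => /(canRL (addKr _)) ->; move: E; lra.
by move=> /eqP; rewrite expf_eq0 /= gt_eqF.
Qed.

(** Every coefficient of the q-recurrence has this form, with [a = lam k + N]
  or [a = 2 lam k + N]; here the sieve appears. *)
Lemma tends1_sieve_ratio (R : realType) (k N : nat) (a : R[i]) :
  (0 < k)%N -> (0 < N)%N ->
  tends1 (fun s =>
      (1 - cpowR s a * omega k ^+ N) / (1 - (s%:C * omega k) ^+ N))
    (if (k %| N)%N then a / N%:R else 1).
Proof.
move=> k0 N0.
pose f (s : R) :=
  (1 - cpowR s a * omega k ^+ N) / (1 - cpowR s N%:R * omega k ^+ N).
suff /tends1_ext : tends1 f (if (k %| N)%N then a / N%:R else 1).
  by apply=> s /andP[s0 _]; rewrite /f [(s%:C * _) ^+ N]exprMn cpowR_nat.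
rewrite /f; case: ifPn => [/dvdnP[c cE]|kN].
  have -> : omega k ^+ N = 1 :> R[i].
    by rewrite cE mulnC exprM omega_expk // expr1n.
  have N1 : N%:R != 0 :> R[i] by rewrite pnatr_eq0 -lt0n.
  by have /tends1_ext := tends1_cpowR_ratio a N1; apply=> s _; rewrite !mulr1.
have w1 : 1 - omega k ^+ N != 0 :> R[i].
  by rewrite subr_eq0 eq_sym omega_exp_neq1.
have H (b : R[i]) :
    tends1 (fun s => 1 - cpowR s b * omega k ^+ N) (1 - omega k ^+ N).
  rewrite -[X in tends1 _ (1 - X)]mul1r.
  exact: tends1B (tends1_cst 1)
    (tends1M (tends1_cpowR b) (tends1_cst (omega k ^+ N))).
by have := tends1M (H a) (tends1V w1 (H N%:R)); rewrite divff.
Qed.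

Arguments tends1_sieve_ratio {R k N} a.

Lemma tends1_qultra (R : realType) (k : nat) (lam : R[i]) (n : nat) (x : R[i]) :
  (1 < k)%N ->
  tends1 (fun s =>
    (qultra (cpowR s (lam * k%:R + 1) * omega k) (s%:C * omega k) n).[x])
    (sieved k lam n).[x].
Proof.
move=> k1; have k0 : (0 < k)%N by rewrite ltnW.
elim/ltn_ind: n => -[|[|n]] IH.
- by rewrite /= hornerE; exact: tends1_cst.
- have := tends1M (tends1_sieve_ratio (lam * k%:R + 1) k0 (isT : 0 < 1)%N)
    (tends1_cst (2 * x)).
  rewrite dvdn1 (gtn_eqF k1) [1 * (2 * x)]mul1r.
  have -> : (sieved k lam 1).[x] = 2 * x by rewrite /= !hornerE.
  move=> /tends1_ext; apply=> s _; rewrite !expr1.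
  move: (cpowR _ _) (s%:C) (omega k) => be q w.
  by rewrite [qultra _ _ _]/= hornerZ hornerX; ring.
have IH1 := IH n.+1 (ltnSn _); have IH0 := IH n (ltnW (ltnSn _)).
have r1 := tends1_sieve_ratio (lam * k%:R + n.+2%:R) k0 (isT : 0 < n.+2)%N.
have r2 := tends1_sieve_ratio (2 * lam * k%:R + n.+2%:R) k0 (isT : 0 < n.+2)%N.
have := tends1B (tends1M r1 (tends1M (tends1_cst (2 * x)) IH1))
  (tends1M r2 IH0).
set l1 := (X in tends1 _ X -> _).
have -> : l1 = (sieved k lam n.+2).[x].
  rewrite /l1 sievedE; case: ifPn => [/dvdnP[c E]|_]; last first.
    by rewrite !(hornerD, hornerN, hornerZ, hornerM, hornerX); ring.
  have c0 : c%:R != 0 :> R[i] by rewrite pnatr_eq0; case: c E.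
  have kR : k%:R != 0 :> R[i] by rewrite pnatr_eq0 -lt0n.
  rewrite !(hornerD, hornerN, hornerZ, hornerM, hornerX) E mulnK // natrM.
  by field; rewrite c0 kR.
move=> /tends1_ext; apply=> s /andP[s0 _].
set be := cpowR s (lam * k%:R + 1) * omega k; set q := s%:C * omega k.
have -> : qultra be q n.+2 = (1 - q ^+ n.+2)^-1 *:
   ((2 * (1 - be * q ^+ n.+1)) *: ('X * qultra be q n.+1)
    - (1 - be ^+ 2 * q ^+ n) *: qultra be q n) by [].
have qE m : q ^+ m = cpowR s m%:R * omega k ^+ m.
  by rewrite /q exprMn cpowR_nat.
have -> : be * q ^+ n.+1 = cpowR s (lam * k%:R + n.+2%:R) * omega k ^+ n.+2.
  have -> : lam * k%:R + n.+2%:R = lam * k%:R + 1 + n.+1%:R by ring.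
  by rewrite qE [in RHS]cpowRD [omega k ^+ n.+2]exprS mulrACA.
have -> : be ^+ 2 * q ^+ n
  = cpowR s (2 * lam * k%:R + n.+2%:R) * omega k ^+ n.+2.
  have -> : 2 * lam * k%:R + n.+2%:R
    = (lam * k%:R + 1) + (lam * k%:R + 1) + n%:R by ring.
  rewrite qE [in RHS]cpowRD [cpowR s (_ + (_ + _))]cpowRD -[n.+2]addn2 exprD.
  by rewrite /be; ring.
by rewrite !(hornerD, hornerN, hornerZ, hornerM, hornerX); ring.
Qed.

Lemma sievedB_horner (R : realType) (k : nat) (lam : R[i]) n (x : R[i]) :
  (1 < k)%N -> sievedB k lam n x = (sieved k lam n).[x].
Proof.
move=> k1; have H := @tends1_qultra R k lam n x k1; rewrite /tends1 in H.
exact: (cvg_lim (@norm_hausdorff _ _) H).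
Qed.

End LeftLimits.

(** * The differential equation *)

Lemma eq_poly_horner (F : numFieldType) (p q : {poly F}) :
  (forall x, p.[x] = q.[x]) -> p = q.
Proof.
move=> E; apply/eqP; rewrite -subr_eq0; apply/eqP.
apply: (@roots_geq_poly_eq0 _ _ [seq i%:R | i <- iota 0 (size (p - q))]).
- by apply/allP => _ /mapP[i _ ->]; rewrite rootE !hornerE E subrr.
- rewrite map_inj_uniq ?iota_uniq // => i j /eqP.
  by rewrite eqr_nat => /eqP.
- by rewrite size_map size_iota.
Qed.

Lemma sieved_ode (F : numFieldType) (k : nat) (l : F) n j :
  (1 < k)%N -> (0 < n)%N -> (j < k)%N ->
  let P := sieved k l (n * k + j) in
  odeJ k l n j * P^`()^`() + odeK k l n j * P^`() + odeL k l n j * P = 0.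
Proof.
case: k => [|[|k]] // _; case: n => // n _; rewrite ltnS leq_eqVlt.
case/predU1P => [->|]; first exact: block_end_ode.
rewrite ltnS => jk; have -> : k = (j + (k - j))%N by rewrite subnKC.
exact: inside_block_ode.
Qed.

Theorem theorem4p3 (R : realType) (k : nat) (lam : R[i])
    (p : nat -> {poly R[i]}) :
  (3 <= k)%N ->
  (forall m : nat, (1 <= m)%N -> lam <> - (m%:R / 2)) ->
  (forall (n : nat) (x : R[i]), (p n).[x] = nu k lam n * sievedB k lam n x) ->
  forall n j : nat, (1 <= n)%N -> (j <= k - 1)%N ->
  odeJ k lam n j * (p (n * k + j)%N)^`()^`()
  + odeK k lam n j * (p (n * k + j)%N)^`()
  + odeL k lam n j * p (n * k + j)%N = 0.
Proof.
move=> k3 _ pE n j n1 jk; have k1 : (1 < k)%N by exact: leq_trans k3.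
have -> : p (n * k + j)%N
    = (nu k lam (n * k + j))%:P * sieved k lam (n * k + j).
  by apply: eq_poly_horner => x; rewrite pE sievedB_horner // hornerM hornerC.
have jk' : (j < k)%N by lia.
have := sieved_ode lam k1 n1 jk'.
move=> /(congr1 ( *%R (nu k lam (n * k + j))%:P)).
rewrite mulr0 => <-; rewrite !(derivM, derivC, mul0r, add0r); ring.
Qed.
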